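(* Let $(\Omega,\mathcal{F},P)$ be a probability space equipped with a filtration $(\mathcal{F}_t)_{t=0}^{\infty}$, and let $T$ be a stopping time with respect to $(\mathcal{F}_t)$ satisfying $P(T>k)>0$ for a fixed $k\in\mathbb{N}$. Let $Z_T=h(X_0,\ldots,X_T)\in L^2(\Omega,\mathcal{F}_T,P)$ be a given terminal value, where $(X_t)_{t=0}^{T}$ is an $(\mathcal{F}_t)$-adapted process. Consider the problem $$f_k^*=\underset{f\in L^2(\mathcal{F}_k)}{\operatorname{arg\,min}}\;E\big[(Z_T-f)^2\,\big|\,T>k\big].$$ Then the minimizer exists, is unique (a.s.), and is given by $$f_k^*=E\big[Z_T\mid\mathcal{F}_k,\;T>k\big].$$
   Context: $L^2(\mathcal{F}_k)$ denotes the space of square-integrable, $\mathcal{F}_k$-measurable real random variables on $(\Omega,\mathcal{F},P)$. $\mathcal{F}_T$ is the sigma-algebra associated with the stopping time $T$. $h$ is a real-valued function of the path $(X_0,\ldots,X_T)$. $E[\,\cdot\mid T>k]$ is the conditional expectation given the event $\{T>k\}$, which has positive probability. Since $T$ is a stopping time, $\{T>k\}\in\mathcal{F}_k$, and conditioning on $(\mathcal{F}_k,\,T>k)$ coincides with conditioning on $\mathcal{F}_k$ on the event $\{T>k\}$.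
   Formalization: Uniqueness of the minimizer, and its equality with the conditional expectation, are stated almost surely on the event {T>k} (i.e. a.s. under P(·|T>k)), since the objective does not see f off {T>k} and uniqueness P-a.s. on all of Ω fails when P(T≤k)>0. *)

(* Defs.v *)
From HB Require Import structures.
From mathcomp Require Import all_boot all_order all_algebra.
From mathcomp Require Import all_classical all_reals all_analysis.

Set Implicit Arguments.
Unset Strict Implicit.
Unset Printing Implicit Defensive.

Import Order.TTheory GRing.Theory Num.Theory.
Import numFieldNormedType.Exports.

Local Open Scope classical_set_scope.
Local Open Scope ring_scope.

(* A sub-sigma-algebra is a set G of subsets of Omega with
   [sigma_algebra setT G]; then [<<s G >> = G], so that measurability for the
   type [g_sigma_algebraType G] is membership in G. *)
Definition filtration d (Omega : measurableType d)
    (F : nat -> set (set Omega)) : Prop :=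
  [/\ forall t, sigma_algebra setT (F t),
      forall t, F t `<=` measurable &
      forall s t, (s <= t)%N -> F s `<=` F t].

(* Random times take values in {0, 1, 2, ...} together with +oo, which is
   encoded as [None]. *)
Definition time_le (Omega : Type) (T : Omega -> option nat) (t : nat)
    : set Omega :=
  [set w | if T w is Some n then (n <= t)%N else false].

Definition time_gt (Omega : Type) (T : Omega -> option nat) (t : nat)
    : set Omega :=
  [set w | if T w is Some n then (t < n)%N else true].

Definition time_ge (Omega : Type) (T : Omega -> option nat) (t : nat)
    : set Omega :=
  [set w | if T w is Some n then (t <= n)%N else true].

Definition stopping_time (Omega : Type) (F : nat -> set (set Omega))
    (T : Omega -> option nat) : Prop :=
  forall t, F t (time_le T t).

Definition stopped_sigma_algebra d (Omega : measurableType d)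
    (F : nat -> set (set Omega)) (T : Omega -> option nat)
    : set (set Omega) :=
  [set A | measurable A /\ forall t, F t (A `&` time_le T t)].

(* The process (X_t), 0 <= t <= T, is only meaningful up to time T: the values
   [X t w] with t > T(w) are irrelevant, and X_t is a function on {t <= T}. *)
Definition adapted_until d d' (Omega : measurableType d)
    (E : measurableType d') (F : nat -> set (set Omega))
    (T : Omega -> option nat) (X : nat -> Omega -> E) : Prop :=
  forall t,
    measurable_fun (time_ge T t : set (g_sigma_algebraType (F t))) (X t).

(* (X_0, ..., X_T), encoded by [Some (X_t)] for t <= T and [None] for t > T,
   so that the length of the path is part of the data. On {T = +oo} this is
   the whole sequence. *)
Definition path_until (Omega E : Type) (X : nat -> Omega -> E)
    (T : Omega -> option nat) (w : Omega) : nat -> option E :=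
  fun t => if `[< time_ge T t w >] then Some (X t w) else None.

Definition L2 d (Omega : measurableType d) (R : realType)
    (P : probability Omega R) (G : set (set Omega)) : set (Omega -> R) :=
  [set f | measurable_fun [set: g_sigma_algebraType G] f
           /\ f \in Lfun P 2%:E].

(* E[Y | B] = E[Y 1_B] / P(B), for an event B with P(B) > 0. *)
Definition expectation_given d (Omega : measurableType d) (R : realType)
    (P : probability Omega R) (B : set Omega) (Y : Omega -> R) : \bar R :=
  ('E_P[(fun w => Y w * \1_B w)%R] * ((fine (P B))^-1)%:E)%E.

(* g is a version of E[Z | G, B], the conditional expectation of Z given the
   sigma-algebra G under the conditional probability P( . | B). *)
Definition is_cond_expectation_given d (Omega : measurableType d)
    (R : realType) (P : probability Omega R) (G : set (set Omega))
    (B : set Omega) (Z g : Omega -> R) : Prop :=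
  [/\ measurable_fun [set: g_sigma_algebraType G] g,
      P.-integrable B (EFin \o g) &
      forall A, G A ->
        expectation_given P B (fun w => g w * \1_A w) =
        expectation_given P B (fun w => Z w * \1_A w)].

Definition argmin (A : Type) (R : realType) (S : set A) (J : A -> \bar R)
    : set A :=
  [set a | S a /\ forall b, S b -> (J a <= J b)%E].

(* Main.v *)
(* Let B = {T > k}, which lies in F_k. A version f of E[Z | F_k, B] exists as
   a Radon-Nikodym density of A |-> E[Z 1_B 1_A] on F_k. It lies in L^2: testing
   against f 1_{|f| <= n} gives E[f^2 1_{|f| <= n}] <= E[Z^2 1_B], and
   n tends to infinity by monotone convergence. Since (Z - f) 1_B is orthogonal
   to F_k-measurable functions,
     E[(Z - g)^2 1_B] = E[(Z - f)^2 1_B] + E[(f - g)^2 1_B]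
   for every g in L^2(F_k), so that f is a minimizer and any other minimizer
   agrees with f a.e. on B. *)
Require Import Defs.
From HB Require Import structures.
From mathcomp Require Import all_boot all_order all_algebra.
From mathcomp Require Import all_classical all_reals all_analysis.
From mathcomp Require Import measurable_realfun.
From mathcomp Require Import ring lra.
Import Order.TTheory GRing.Theory Num.Theory.
Import numFieldNormedType.Exports.
Local Open Scope classical_set_scope.
Local Open Scope ring_scope.

Set Implicit Arguments.
Unset Strict Implicit.

(** * Integrability and expectations against indicators *)

Lemma expectation_mul_indic d (Omega : measurableType d) (R : realType)
    (P : probability Omega R) (Y : Omega -> R) (A : set Omega) :
  'E_P[(fun w => Y w * \1_A w)%R]%E = (\int[P]_(w in A) (Y w)%:E)%E.
Proof.
rewrite unlock [RHS]integral_mkcond; apply: eq_integral => w _.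
by rewrite patchE indicE; case: ifPn => _; rewrite ?mulr1 ?mulr0.
Qed.

Lemma Lfun1_le d (Omega : measurableType d) (R : realType)
    (mu : {measure set Omega -> \bar R}) (X Y : Omega -> R) :
  measurable_fun [set: Omega] X -> (forall w, `|X w| <= `|Y w|) ->
  Y \in Lfun mu 1 -> X \in Lfun mu 1.
Proof.
move=> mX XY /Lfun1_integrable iY; apply/Lfun1_integrable.
apply: le_integrable iY => //; first exact/measurable_EFinP.
by move=> w _ /=; rewrite lee_fin.
Qed.

Lemma Lfun_measurable d (Omega : measurableType d) (R : realType)
    (mu : {measure set Omega -> \bar R}) (p : \bar R) (X : Omega -> R) :
  X \in Lfun mu p -> measurable_fun [set: Omega] X.
Proof. by move=> /sub_Lfun_mfun; rewrite inE. Qed.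

Lemma Lfun1_mul_indic d (Omega : measurableType d) (R : realType)
    (mu : {measure set Omega -> \bar R}) (X : Omega -> R) (A : set Omega) :
  measurable A -> X \in Lfun mu 1 -> (fun w => X w * \1_A w) \in Lfun mu 1.
Proof.
move=> mA L1X; apply: Lfun1_le (L1X).
  apply: measurable_funM; first exact: Lfun_measurable L1X.
  exact: measurable_indic.
move=> w; rewrite indicE normrM; case: (_ \in _).
  by rewrite normr1 mulr1.
by rewrite normr0 mulr0.
Qed.

Lemma Lfun2_sqr d (Omega : measurableType d) (R : realType)
    (mu : {measure set Omega -> \bar R}) (X : Omega -> R) :
  measurable_fun [set: Omega] X ->
  (\int[mu]_w (X w ^+ 2)%:E < +oo)%E -> X \in Lfun mu 2%:E.
Proof.
move=> mX X2; rewrite inE; apply/andP; split; rewrite inE//=.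
rewrite /finite_norm unlock; apply: poweR_lty.
apply: le_lt_trans X2; rewrite le_eqVlt; apply/orP; left; apply/eqP.
by apply: eq_integral => w _ /=; rewrite powR_mulrn// real_normK// num_real.
Qed.

(** * Conditional expectation given a sub-sigma-algebra [G] *)

Section sub_sigma_algebra.
Context d (Omega : measurableType d) (R : realType).
Variables (P : probability Omega R) (G : set (set Omega)).
Hypotheses (sG : sigma_algebra setT G) (GM : G `<=` measurable).

Local Notation gT := (g_sigma_algebraType G).

Let mG (A : set gT) : measurable A = G A.
Proof. by rewrite measurable_g_measurableTypeE. Qed.

(** Through this map, restricting a measure to [G] becomes a pushforward. *)
Lemma measurable_id_sub : measurable_fun [set: Omega] (id : Omega -> gT).
Proof. by move=> _ A; rewrite mG setTI => /GM. Qed.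

Lemma measurable_fun_sub d' (T : measurableType d') (f : Omega -> T) :
  measurable_fun [set: gT] f -> measurable_fun [set: Omega] f.
Proof.
move=> mf; apply: (@measurableT_comp _ _ _ _ _ _ (f : gT -> T)) => //.
exact: measurable_id_sub.
Qed.

Lemma exists_cond_expectation (Y : Omega -> R) : Y \in Lfun P 1 ->
  exists g : Omega -> R, [/\ measurable_fun [set: gT] g, g \in Lfun P 1 &
    forall A, G A ->
      'E_P[(fun w => g w * \1_A w)%R]%E = 'E_P[(fun w => Y w * \1_A w)%R]%E].
Proof.
move=> /Lfun1_integrable intY.
have mid := measurable_id_sub.
pose mid' : {mfun Omega >-> gT} := HB.pack (id : Omega -> gT)
  (isMeasurableFun.Build _ _ _ _ _ mid).
(* Since [mid'] is the identity, [Q] is the restriction of [P] to [G]. Likewise [nu] below is the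
   restriction to [G] of the charge A |-> E[Y 1_A], and the version sought is the density of [nu]
   with respect to [Q]. *)
pose Q : probability gT R := distribution P mid'.
(* [pushforward] is a charge only relative to a measurability proof. *)
pose nu_ : {charge set gT -> \bar R} := pushforward (induced_charge intY) mid'.
pose nu := nu_ mid.
have nuQ : nu `<< Q.
  apply/null_content_dominatesP => A; rewrite mG => GA QA0.
  apply: null_set_integral => //; first exact: GM.
  by apply: measurable_funTS; exact: measurable_int intY.
pose f : gT -> \bar R := Radon_Nikodym nu Q.
have intf : Q.-integrable [set: gT] f by exact: Radon_Nikodym_integrable.
(* The density is finite at every point, so passing to the real-valued [fine \o f] loses nothing. *)
have fE w : (fine (f w))%:E = f w.
  by rewrite fineK//; exact: Radon_Nikodym_fin_num.
have mf : measurable_fun [set: gT] f by exact: measurable_int intf.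
have intfP : P.-integrable [set: Omega] f.
  apply/integrableP; split; first exact: measurable_fun_sub.
  have /integrableP[_] := intf.
  by rewrite ge0_integral_pushforward//; exact: measurableT_comp.
exists (fine \o f); split.
- exact: measurableT_comp.
- apply/Lfun1_integrable; apply: eq_integrable intfP => // w _.
  by rewrite /= fE.
- move=> A GA; rewrite !expectation_mul_indic.
  under eq_integral do rewrite fE.
  have mA : measurable (A : set gT) by rewrite mG.
  (* By definition [nu A] is the integral of [Y] over [A]; that it is also the integral of [f] over
     [A] is the Radon-Nikodym property, transported from [Q] back to [P]. *)
  transitivity (nu A); last by [].
  rewrite (Radon_Nikodym_integral nuQ mA) integral_pushforward//.
  by apply: integrableS intfP => //; exact: GM.
Qed.

(** * From orthogonality to indicators to orthogonality to [G]-measurable functions *)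

Section orthogonality.
Import HBNNSimple.
Variable Y : Omega -> R.
Hypothesis L1Y : Y \in Lfun P 1.
Hypothesis Y0 : forall A, G A -> 'E_P[(fun w => Y w * \1_A w)%R]%E = 0%E.

Let mY : measurable_fun [set: Omega] Y. Proof. exact: Lfun_measurable L1Y. Qed.

Let expectation_mul_nnsfun0 (s : {nnsfun gT >-> R}) :
  'E_P[(fun w => Y w * s w)%R]%E = 0%E.
Proof.
have GI r : G (s @^-1` [set r]).
  by rewrite -mG -[X in measurable X]setTI; exact: measurable_funP.
(* A simple function is a finite combination of indicators of its level sets, and these belong to
   [G]. *)
have -> : (fun w => Y w * s w) = (fun w =>
    \sum_(r <- finmap.enum_fset (fset_set (range s)))
      r * (Y w * \1_(s @^-1` [set r]) w)).
  apply/funext => w; rewrite (fimfunE s) fsbig_finite//= mulr_sumr.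
  by apply: eq_bigr => r _; rewrite mulrCA.
have L1I r : (fun w => Y w * \1_(s @^-1` [set r]) w) \in Lfun P 1.
  exact: Lfun1_mul_indic (GM (GI r)) L1Y.
rewrite unlock; under eq_integral do rewrite -sumEFin.
rewrite integral_sum//=; last first.
  move=> r; under eq_fun do rewrite EFinM.
  exact/integrableZl/Lfun1_integrable.
rewrite big1// => r _; under eq_integral do rewrite EFinM.
rewrite integralZl//; last exact/Lfun1_integrable.
by have := Y0 (GI r); rewrite unlock => ->; rewrite mule0.
Qed.

(** Simple functions increasing to [phi] have products with [Y] dominated by [|Y * phi|], so
    dominated convergence carries the zero expectation to the limit. *)
Let expectation_mul_ge0_sub0 (phi : Omega -> R) : (forall w, 0 <= phi w) ->
  measurable_fun [set: gT] phi -> (fun w => Y w * phi w) \in Lfun P 1 ->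
  'E_P[(fun w => Y w * phi w)%R]%E = 0%E.
Proof.
move=> phi0 mphi L1Yphi.
have mphi' : measurable_fun [set: gT] (EFin \o phi) by exact/measurable_EFinP.
pose s := nnsfun_approx measurableT mphi'.
have phi0' (w : gT) : [set: gT] w -> (0 <= (EFin \o phi) w)%E.
  by rewrite lee_fin.
have ms n : measurable_fun [set: Omega] (s n) by exact: measurable_fun_sub.
have s_le n w : s n w <= phi w.
  by rewrite -lee_fin /s nnsfun_approxE; exact: le_approx.
have [|||||_ _] := @dominated_convergence _ _ _ P setT measurableT
  (fun n w => (Y w * s n w)%:E) (fun w => (Y w * phi w)%:E)
  (fun w => `|Y w * phi w|%:E).
- by move=> n; apply/measurable_EFinP; exact: measurable_funM.
- by apply/measurable_EFinP; exact: Lfun_measurable L1Yphi.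
- apply: aeW => w _; apply/fine_cvgP; split; first exact: nearW.
  apply: cvgM; first exact: cvg_cst.
  have wT : [set: gT] w by [].
  by have /fine_cvgP[] := cvg_nnsfun_approx measurableT mphi' phi0' wT.
- by have /Lfun1_integrable/integrable_norm := L1Yphi.
- apply: aeW => w n _; rewrite lee_fin !normrM ler_wpM2l//.
  by rewrite !ger0_norm.
move=> cvgY; rewrite unlock -(cvg_lim _ cvgY)//.
apply: lim_near_cst => //; apply: nearW => n.
by have := expectation_mul_nnsfun0 (s n); rewrite unlock.
Qed.

(** The positive and negative parts of [phi] are bounded by [|phi|], so their products with [Y] stay
    integrable and the nonnegative case applies to each. *)
Lemma expectation_mul_sub0 (phi : Omega -> R) :
  measurable_fun [set: gT] phi -> (fun w => Y w * phi w) \in Lfun P 1 ->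
  'E_P[(fun w => Y w * phi w)%R]%E = 0%E.
Proof.
move=> mphi L1Yphi.
have mphip : measurable_fun [set: gT] phi^\+ by exact: measurable_funrpos.
have mphin : measurable_fun [set: gT] phi^\- by exact: measurable_funrneg.
have L1p : (fun w => Y w * phi^\+ w) \in Lfun P 1.
  apply: Lfun1_le L1Yphi; first exact/measurable_funM/measurable_fun_sub.
  move=> w; rewrite !normrM ler_wpM2l// ger0_norm ?funrpos_ge0//.
  by rewrite /funrpos ge_max ler_norm normr_ge0.
have L1n : (fun w => Y w * phi^\- w) \in Lfun P 1.
  apply: Lfun1_le L1Yphi; first exact/measurable_funM/measurable_fun_sub.
  move=> w; rewrite !normrM ler_wpM2l// ger0_norm ?funrneg_ge0//.
  by rewrite /funrneg ge_max -normrN ler_norm normr_ge0.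
have -> : (fun w => Y w * phi w) =
    (fun w => Y w * phi^\+ w) \- (fun w => Y w * phi^\- w).
  by apply/funext => w /=; rewrite -mulrBr -[in LHS](funrposBneg phi).
by rewrite expectationB// !expectation_mul_ge0_sub0 ?sube0.
Qed.

End orthogonality.

(** Testing against [g] itself would presuppose that [g ^+ 2] is integrable; truncating [g] to the
    sets [A n] avoids this and gives a bound uniform in [n]. *)
Lemma cond_expectation_Lfun2 (Y g : Omega -> R) : Y \in Lfun P 2%:E ->
  measurable_fun [set: gT] g -> g \in Lfun P 1 ->
  (forall A, G A ->
    'E_P[(fun w => g w * \1_A w)%R]%E = 'E_P[(fun w => Y w * \1_A w)%R]%E) ->
  g \in Lfun P 2%:E.
Proof.
move=> L2Y mg L1g gY.
have mg' := measurable_fun_sub mg.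
have mY := Lfun_measurable L2Y.
have L1Y : Y \in Lfun P 1 by apply: Lfun_subset12 L2Y; exact: fin_num_measure.
have iY2 := Lfun2_integrable_sqr L2Y.
pose A n := [set w | `|g w| <= n%:R].
have GA n : G (A n).
  rewrite -mG -[X in measurable X]setTI.
  apply: (@measurable_fun_le _ gT R setT (fun w => `|g w|) (cst n%:R)) => //.
  exact: measurableT_comp.
have mA n : measurable (A n) by exact/GM/GA.
have g2_le n : (\int[P]_(w in A n) (g w ^+ 2)%:E <= \int[P]_w (Y w ^+ 2)%:E)%E.
  rewrite -expectation_mul_indic.
  (* With the factor 2, on [A n] one has Y^2 - (Y - g) phi = g^2 + (Y - g)^2. Subtracting a term of
     zero expectation from Y^2 thus yields the bound directly. *)
  pose phi w := 2 * (g w * \1_(A n) w).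
  have mphi : measurable_fun [set: gT] phi.
    apply: measurable_funM => //; apply: measurable_funM => //.
    by apply: measurable_indic; rewrite mG.
  have L1Yg : Y \- g \in Lfun P 1 by exact: rpredB.
  have L1Ygphi : (fun w => (Y w - g w) * phi w) \in Lfun P 1.
    (* The constant bounds [|phi|]: on [A n] by the choice of truncation, elsewhere because [phi]
       vanishes. *)
    apply: Lfun1_le (Lfun_scale (2 * n%:R) (lexx 1) L1Yg).
      apply: measurable_funM; first exact: measurable_funB.
      exact: measurable_fun_sub.
    move=> w /=; rewrite !normrM ler_wpM2l//.
    rewrite (@ger0_norm _ 2)// ler_wpM2l//.
    rewrite indicE (@ger0_norm _ n%:R)//; case: (boolP (w \in A n)) => [|_].
      by rewrite inE normr1 mulr1.
    by rewrite normr0 mulr0.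
  have E0 : 'E_P[(fun w => (Y w - g w) * phi w)%R]%E = 0%E.
    apply: (@expectation_mul_sub0 (Y \- g)) => // B GB.
    have mB := GM GB.
    have -> : (fun w => (Y \- g) w * \1_B w) =
        (fun w => Y w * \1_B w) \- (fun w => g w * \1_B w).
      by apply/funext => w /=; rewrite mulrBl.
    rewrite expectationB ?Lfun1_mul_indic// gY// subee//.
    by rewrite expectation_fin_num// Lfun1_mul_indic.
  have L1Y2 : (fun w => Y w ^+ 2) \in Lfun P 1 by exact/Lfun1_integrable.
  have -> : (\int[P]_w (Y w ^+ 2)%:E)%E =
      'E_P[((fun w => Y w ^+ 2) \- (fun w => (Y w - g w) * phi w))%R]%E.
    by rewrite expectationB// E0 sube0 unlock.
  (* On [A n] the difference is [(Y - g) ^+ 2]. *)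
  have le w : g w ^+ 2 * \1_(A n) w <= Y w ^+ 2 - (Y w - g w) * phi w.
    rewrite /phi indicE; case: (_ \in _); last first.
      by rewrite !mulr0 subr0 sqr_ge0.
    by rewrite !mulr1; have := sqr_ge0 (Y w - g w); lra.
  have ge0 w : 0 <= g w ^+ 2 * \1_(A n) w by rewrite mulr_ge0 ?sqr_ge0.
  apply: expectation_le => //; last exact: aeW.
  - by apply: measurable_funM => //; exact: measurable_funX.
  - by apply: (@Lfun_measurable _ _ _ P 1); exact: rpredB.
  - by move=> w; exact: le_trans (ge0 w) (le w).
apply: Lfun2_sqr => //.
apply: le_lt_trans (integrable_lty _ iY2) => //.
(* The sets [A n] increase to the whole space because [g] is real-valued, so monotone convergence
   passes the uniform bound to the integral of [g ^+ 2]. *)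
have cvgA : (\int[P]_(w in A n) (g w ^+ 2)%:E)%E @[n --> \oo] -->
    (\int[P]_w (g w ^+ 2)%:E)%E.
  have -> : [set: Omega] = \bigcup_n A n.
    apply/esym/seteqP; split => // w _; exists (Num.truncn `|g w|).+1 => //=.
    exact/ltW/Num.Theory.truncnS_gt.
  apply: ge0_nondecreasing_set_cvg_integral => //.
  - move=> m n mn; apply/subsetPset => w /= /le_trans; apply.
    by rewrite ler_nat.
  - move=> n; apply/measurable_EFinP/measurable_funTS.
    exact: measurable_funX.
  - by move=> n w _; rewrite lee_fin sqr_ge0.
rewrite -(cvg_lim _ cvgA)//.
apply: lime_le; first by apply/cvg_ex; eexists; exact: cvgA.
exact: nearW.
Qed.

(** * Orthogonal projection conditionally on an event [B] of [G] *)

Section projection.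
Variables (B : set Omega) (Z : Omega -> R).
Hypotheses (GB : G B) (PB0 : (0 < P B)%E) (L2Z : Z \in Lfun P 2%:E).

Let mB : measurable B. Proof. exact: GM. Qed.

Let Lfun21 (X : Omega -> R) : X \in Lfun P 2%:E -> X \in Lfun P 1.
Proof. by apply: Lfun_subset12; exact: fin_num_measure. Qed.

Let Lfun2B (X X' : Omega -> R) : X \in Lfun P 2%:E ->
  X' \in Lfun P 2%:E -> X \- X' \in Lfun P 2%:E.
Proof. by move=> ? ?; apply: rpredB => //; rewrite lee1n. Qed.

Let Lfun2_sqrB (X X' : Omega -> R) : X \in Lfun P 2%:E ->
  X' \in Lfun P 2%:E -> (fun w => (X w - X' w) ^+ 2 * \1_B w) \in Lfun P 1.
Proof.
move=> L2X L2X'; apply: Lfun1_mul_indic => //.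
by apply/Lfun1_integrable/(@Lfun2_integrable_sqr _ _ _ P (X \- X'))/Lfun2B.
Qed.

Let c_gt0 : 0 < (fine (P B))^-1.
Proof.
by rewrite invr_gt0 fine_gt0// PB0 -ge0_fin_numE// fin_num_measure.
Qed.

(** The normalising factor 1 / P(B) is positive and finite, so it cancels and the rest of the
    argument can use unnormalised expectations over [B]. *)
Lemma expectation_given_le (X Y : Omega -> R) :
  (expectation_given P B X <= expectation_given P B Y)%E =
  ('E_P[(fun w => X w * \1_B w)%R] <= 'E_P[(fun w => Y w * \1_B w)%R])%E.
Proof. by rewrite /expectation_given lee_pmul2r. Qed.

Lemma expectation_given_inj (X Y : Omega -> R) :
  expectation_given P B X = expectation_given P B Y ->
  'E_P[(fun w => X w * \1_B w)%R]%E = 'E_P[(fun w => Y w * \1_B w)%R]%E.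
Proof.
by move=> /eqP; rewrite eq_le !expectation_given_le -eq_le => /eqP.
Qed.

(** Pythagoras: the cross term is the expectation of [Y w * (2 * (f w - g w))], integrable as a
    product of square-integrable functions, and zero since [Y] is orthogonal to the [G]-measurable
    [f - g]. *)
Lemma expectation_sqr_decomp (f g : Omega -> R) :
  L2 P G f -> L2 P G g -> is_cond_expectation_given P G B Z f ->
  'E_P[(fun w => (Z w - g w) ^+ 2 * \1_B w)%R]%E =
  ('E_P[(fun w => (Z w - f w) ^+ 2 * \1_B w)%R] +
   'E_P[(fun w => (f w - g w) ^+ 2 * \1_B w)%R])%E.
Proof.
move=> [mf L2f] [mg L2g] [_ _ Zf].
pose Y w := (Z w - f w) * \1_B w.
have L1Y : Y \in Lfun P 1.
  apply: (@Lfun1_mul_indic _ _ _ _ (Z \- f)) => //.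
  by apply: Lfun21; exact: Lfun2B.
have Y0 A : G A -> 'E_P[(fun w => Y w * \1_A w)%R]%E = 0%E.
  move=> GA; have mA := GM GA.
  have /expectation_given_inj EA := Zf _ GA.
  have L1AB (X : Omega -> R) : X \in Lfun P 1 ->
      (fun w => X w * \1_A w * \1_B w) \in Lfun P 1.
    by move=> L1X; do 2!apply: Lfun1_mul_indic => //.
  have -> : (fun w => Y w * \1_A w) =
      (fun w => Z w * \1_A w * \1_B w) \- (fun w => f w * \1_A w * \1_B w).
    by apply/funext => w /=; rewrite /Y; ring.
  rewrite expectationB ?L1AB ?Lfun21// EA subee//.
  by rewrite expectation_fin_num// L1AB// Lfun21.
have L1Yfg : (fun w => Y w * (2 * (f w - g w))) \in Lfun P 1.
  have -> : (fun w => Y w * (2 * (f w - g w))) =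
      (fun w => (2 \o* ((Z \- f) \* (f \- g))) w * \1_B w).
    by apply/funext => w /=; rewrite /Y; ring.
  apply: Lfun1_mul_indic => //; apply: Lfun_scale => //.
  by apply: Lfun2_mul_Lfun1; exact: Lfun2B.
have E0 : 'E_P[(fun w => Y w * (2 * (f w - g w)))%R]%E = 0%E.
  apply: expectation_mul_sub0 => //.
  by apply: measurable_funM => //; exact: measurable_funB.
have -> : (fun w => (Z w - g w) ^+ 2 * \1_B w) =
    (fun w => (Z w - f w) ^+ 2 * \1_B w) \+
    (fun w => (f w - g w) ^+ 2 * \1_B w) \+
    (fun w => Y w * (2 * (f w - g w))).
  by apply/funext => w /=; rewrite /Y; ring.
rewrite expectationD ?E0 ?adde0 ?expectationD ?Lfun2_sqrB//.
by apply: rpredD; exact: Lfun2_sqrB.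
Qed.

(** The witness is the unconditional version of E[Z 1_B | G]; because [B] is in [G], its defining
    identity may be tested on [A] intersected with [B]. *)
Lemma exists_cond_expectation_given :
  exists f, L2 P G f /\ is_cond_expectation_given P G B Z f.
Proof.
have mZ := Lfun_measurable L2Z.
pose Y w := Z w * \1_B w.
have mY : measurable_fun [set: Omega] Y.
  by apply: measurable_funM => //; exact: measurable_indic.
have L2Y : Y \in Lfun P 2%:E.
  apply: Lfun2_sqr => //.
  apply: le_lt_trans (integrable_lty _ (Lfun2_integrable_sqr L2Z)) => //.
  apply: ge0_le_integral => //.
  - by move=> w _; rewrite lee_fin sqr_ge0.
  - exact/measurable_EFinP/measurable_funX.
  - exact/measurable_EFinP/measurable_funX.
  - move=> w _; rewrite lee_fin exprMn indicE; case: (_ \in _).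
      by rewrite expr1n mulr1.
    by rewrite expr0n mulr0 sqr_ge0.
have [f [mf L1f fY]] := exists_cond_expectation (Lfun21 L2Y).
have L2f := cond_expectation_Lfun2 L2Y mf L1f fY.
exists f; split; first by split.
split => //.
  by apply: (@integrableS _ _ _ _ setT) => //; exact/Lfun1_integrable.
move=> A GA; rewrite /expectation_given.
have GAB : G (A `&` B) by rewrite -mG; apply: measurableI; rewrite mG.
have EAB (X : Omega -> R) : (fun w => X w * \1_A w * \1_B w) =
    (fun w => X w * \1_(A `&` B) w).
  by apply/funext => w; rewrite indicI /= mulrA.
rewrite !EAB (fY _ GAB); congr (expectation _ _ * _)%E.
apply/funext => w; rewrite /Y indicI /= !indicE.
by case: (w \in B); rewrite ?mulr1 ?mulr0.
Qed.

Lemma argmin_cond_expectation (f : Omega -> R) :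
  L2 P G f -> is_cond_expectation_given P G B Z f ->
  argmin (L2 P G)
    (fun f => expectation_given P B (fun w => (Z w - f w) ^+ 2)) f.
Proof.
move=> L2f CEf; split => // g L2g.
rewrite expectation_given_le (expectation_sqr_decomp L2f L2g CEf).
rewrite leeDl// expectation_ge0// => w.
by rewrite mulr_ge0 ?sqr_ge0.
Qed.

(** Agreement is claimed on [B] only: the criterion does not see values taken off [B]. *)
Lemma argmin_ae_eq (f g : Omega -> R) :
  L2 P G f -> is_cond_expectation_given P G B Z f ->
  argmin (L2 P G)
    (fun f => expectation_given P B (fun w => (Z w - f w) ^+ 2)) g ->
  ae_eq P B f g.
Proof.
move=> L2f CEf [L2g /(_ _ L2f)].
rewrite expectation_given_le (expectation_sqr_decomp L2f L2g CEf).
have [_ L2f'] := L2f; have [_ L2g'] := L2g.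
(* The common term E[(Z - f)^2 1_B] is finite, hence can be cancelled, leaving E[(f - g)^2 1_B] <=
   0. *)
rewrite -[leRHS]adde0 leeD2lE ?expectation_fin_num ?Lfun2_sqrB// => le0.
have : 'E_P[(fun w => (f w - g w) ^+ 2 * \1_B w)%R]%E = 0%E.
  apply/eqP; rewrite eq_le le0 expectation_ge0// => w.
  by rewrite mulr_ge0 ?sqr_ge0.
rewrite expectation_mul_indic => E0.
have : (\int[P]_(w in B) `|((f w - g w) ^+ 2)%:E| = 0)%E.
  rewrite -[RHS]E0; apply: eq_integral => w _.
  by rewrite gee0_abs// lee_fin sqr_ge0.
move=> /ae_eq_integral_abs[//||N [mN N0 sN]].
  apply/measurable_EFinP/measurable_funTS/measurable_funX/measurable_funB.
    exact: Lfun_measurable L2f'.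
  exact: Lfun_measurable L2g'.
exists N; split => // w /= fg; apply: sN => /=.
apply: contra_not fg => + Bw => /(_ Bw)/eqP.
by rewrite eqe sqrf_eq0 subr_eq0 => /eqP.
Qed.

(** All test integrals are taken over [B], so they ignore changes off [B] or on a null set. This
    turns uniqueness of the minimizer into its identification as a conditional expectation. *)
Lemma is_cond_expectation_given_ae_eq (f g : Omega -> R) :
  L2 P G g -> is_cond_expectation_given P G B Z f ->
  ae_eq P B f g -> is_cond_expectation_given P G B Z g.
Proof.
move=> [mg L2g] [mf _ CEf] fg; split => //.
  by apply: (@integrableS _ _ _ _ setT) => //; exact/Lfun1_integrable/Lfun21.
move=> A GA; rewrite -CEf//; congr (_ * _)%E; rewrite !expectation_mul_indic.
have mA := GM GA.
have mXA (X : Omega -> R) : measurable_fun [set: gT] X ->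
    measurable_fun B (fun w => (X w * \1_A w)%:E).
  move=> mX; apply/measurable_EFinP/measurable_funTS/measurable_funM.
    exact: measurable_fun_sub.
  exact: measurable_indic.
apply: ae_eq_integral => //.
- exact: mXA.
- exact: mXA.
- by apply: filterS fg => w /[apply] ->.
Qed.

End projection.
End sub_sigma_algebra.

(** * The minimization problem given that [T] exceeds [k] *)

Unset Implicit Arguments.

Theorem lemma1 (R : realType) (d d' : measure_display)
    (Omega : measurableType d) (P : probability Omega R)
    (E : measurableType d')
    (F : nat -> set (set Omega)) (hF : filtration F)
    (T : Omega -> option nat) (hT : stopping_time F T)
    (k : nat) (hk : (0 < P (time_gt T k))%E)
    (X : nat -> Omega -> E) (hX : adapted_until F T X)
    (h : (nat -> option E) -> R)
    (Z : Omega -> R) (hZ : forall w, Z w = h (path_until X T w))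
    (hZ2 : L2 P (stopped_sigma_algebra F T) Z) :
  let B := time_gt T k in
  let minimizers := argmin (L2 P (F k))
    (fun f => expectation_given P B (fun w => (Z w - f w) ^+ 2)) in
  [/\ exists f, minimizers f,
      forall f g, minimizers f -> minimizers g -> ae_eq P B f g &
      forall f, minimizers f <->
        L2 P (F k) f /\ is_cond_expectation_given P (F k) B Z f].
Proof.
move=> B minimizers.
have [sF FM _] := hF.
have [_ L2Z] := hZ2.
have GB : F k B.
  (* The value [None], that is T = +oo, lies in [B] and outside [time_le T k], so the two sets are
     exact complements. *)
  suff -> : B = [set: Omega] `\` time_le T k.
    by have [_ + _] := sF k; apply; exact: hT.
  apply/seteqP; split => w; rewrite /B /time_gt /time_le /=.
    by case: (T w) => [n /= kn|_]; split => //; apply/negP; rewrite -ltnNge.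
  by case: (T w) => [n [_ /negP]|//]; rewrite -ltnNge.
(* This one version serves as reference: it is a minimizer, and every minimizer is compared with it
   on [B]. *)
have [f0 [L2f0 CEf0]] := exists_cond_expectation_given (sF k) (FM k) GB L2Z.
split.
- exists f0; exact: argmin_cond_expectation.
- move=> f g mf mg.
  have := argmin_ae_eq (sF k) (FM k) GB hk L2Z L2f0 CEf0 mf.
  have := argmin_ae_eq (sF k) (FM k) GB hk L2Z L2f0 CEf0 mg.
  by apply: filterS2 => w f0g f0f Bw; rewrite -f0g// f0f.
- move=> f; split => [mf|[L2f CEf]]; last exact: argmin_cond_expectation.
  split; first by case: mf.
  apply: is_cond_expectation_given_ae_eq (CEf0) _ => //; first by case: mf.
  exact: (argmin_ae_eq (sF k) (FM k) GB hk L2Z L2f0 CEf0 mf).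
Qed.
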